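(* For $t\ge 2$ and $q=4^t$, the code $C^t=\mathrm{Ext}(C_{q/4},C_L)\cup \mathrm{Ext}(C^{t-1},Di)$ (defined recursively starting from the code $C^1$) is an identifying code in $K_q^3$ and has cardinality $q^2-\frac{q}{4}$.
   Context: $K_q^3=K_q\square K_q\square K_q$ is the graph with vertex set $\{(x,y,z)\in\mathbb{Z}^3\mid 1\le x,y,z\le q\}$ in which two distinct vertices are adjacent iff they differ in exactly one coordinate. $N[v]$ is the closed neighbourhood of $v$; a code is a nonempty set $C$ of vertices; $I(u)=N[u]\cap C$. A code $C$ is identifying in a graph if $I(u)\ne\emptyset$ for every vertex $u$ and $I(u)\neq I(v)$ for all distinct vertices $u,v$. For codes $A$ in $K_m^3$ and $B$ in $K_p^3$, define $\mathrm{Ext}(A,B)=\{(x,y,z,a,b,c)\mid (x,y,z)\in A,\ (a,b,c)\in B\}$. A sextuple $(x,y,z,a,b,c)$ with $1\le x,y,z\le m$ and $1\le a,b,c\le p$ is identified with the vertex $(x+m(a-1),\,y+m(b-1),\,z+m(c-1))$ of $K_{mp}^3$, so that $\mathrm{Ext}(A,B)$ is a code in $K_{mp}^3$. (For $C^t$ one takes $m=q/4$ and $p=4$.) For a positive integer $m$, $C_m=\{(a,b,c)\mid 1\le a,b,c\le m,\ a+b+c\equiv 0 \pmod m\}$, a code in $K_m^3$. In $K_4^3$: $Di=\{(j,j,j)\mid 1\le j\le 4\}$; $C_L=\{(2,1,3),(3,1,4),(4,1,2),(1,2,4),(3,2,1),(4,2,3),(1,3,2),(2,3,4),(4,3,1),(1,4,3),(2,4,1),(3,4,2)\}$;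 $C^1=\{(2,1,3),(2,1,4),(3,1,1),(4,1,2),(1,2,2),(1,2,4),(2,2,4),(3,2,2),(1,3,1),(2,3,2),(3,3,3),(4,3,3),(2,4,4),(4,4,1),(4,4,3)\}$. For $t\ge2$, $C^t$ is defined recursively by the formula in the claim. *)

(* Defs.v *)
From mathcomp Require Import all_boot.

Set Implicit Arguments.
Unset Strict Implicit.
Unset Printing Implicit Defensive.

(* Identifying codes in a finite graph given by its adjacency relation. *)

Definition closed_nbhd (T : finType) (e : rel T) (v : T) : {set T} :=
  v |: [set u | e v u].

Definition Iset (T : finType) (e : rel T) (C : {set T}) (u : T) : {set T} :=
  closed_nbhd e u :&: C.

(* The first condition is the convention that a code is a nonempty set. *)
Definition identifying_code (T : finType) (e : rel T) (C : {set T}) : Prop :=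
  [/\ C != set0,
      forall u : T, Iset e C u != set0
    & forall u v : T, u <> v -> Iset e C u <> Iset e C v].

(* The graph K_q [] K_q [] K_q.  An element i of 'I_q encodes the coordinate
   i + 1, so coordinates range over 1, ..., q; [coords] gives the resulting
   triple of numbers. *)

Definition vertex (q : nat) : finType := ('I_q * 'I_q * 'I_q)%type.

Definition coords (q : nat) (v : vertex q) : nat * nat * nat :=
  (v.1.1.+1, v.1.2.+1, v.2.+1).

Definition cube_adj (q : nat) : rel (vertex q) := fun u v =>
  (u.1.1 != v.1.1) + (u.1.2 != v.1.2) + (u.2 != v.2) == 1.

(* The identification (x, a) |-> x + m (a - 1), which reads x + m a on the
   zero-based elements of 'I_m and 'I_p; see [ext_coordE].  The size is written
   p * m, not m * p, so that 4 * 4 ^ s.+1 is convertible to 4 ^ s.+2. *)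

Lemma ext_coord_subproof (m p : nat) (x : 'I_m) (a : 'I_p) :
  x + m * a < p * m.
Proof.
apply: (@leq_trans (m + m * a)); first by rewrite ltn_add2r.
by rewrite -mulnS mulnC leq_mul2r ltn_ord orbT.
Qed.

Definition ext_coord (m p : nat) (x : 'I_m) (a : 'I_p) : 'I_(p * m) :=
  Ordinal (ext_coord_subproof x a).

Lemma ext_coordE (m p : nat) (x : 'I_m) (a : 'I_p) :
  (ext_coord x a).+1 = x.+1 + m * (a.+1 - 1).
Proof. by rewrite subn1. Qed.

Definition ext_vertex (m p : nat) (u : vertex m) (v : vertex p) :
    vertex (p * m) :=
  (ext_coord u.1.1 v.1.1, ext_coord u.1.2 v.1.2, ext_coord u.2 v.2).

Definition Ext (m p : nat) (A : {set vertex m}) (B : {set vertex p}) :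
    {set vertex (p * m)} :=
  [set ext_vertex u v | u in A, v in B].

Definition Cmod (m : nat) : {set vertex m} :=
  [set v | let: (a, b, c) := coords v in a + b + c == 0 %[mod m]].

Definition Di : {set vertex 4} := [set (j, j, j) | j : 'I_4].

Definition CL : {set vertex 4} :=
  [set v | coords v \in
    [:: (2,1,3); (3,1,4); (4,1,2); (1,2,4); (3,2,1); (4,2,3);
        (1,3,2); (2,3,4); (4,3,1); (1,4,3); (2,4,1); (3,4,2)]].

Definition C1 : {set vertex 4} :=
  [set v | coords v \in
    [:: (2,1,3); (2,1,4); (3,1,1); (4,1,2); (1,2,2); (1,2,4); (2,2,4);
        (3,2,2); (1,3,1); (2,3,2); (3,3,3); (4,3,3); (2,4,4); (4,4,1);
        (4,4,3)]].

(* [Csucc s] is C^(s + 1). *)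
Fixpoint Csucc (s : nat) : {set vertex (4 ^ s.+1)} :=
  match s return {set vertex (4 ^ s.+1)} with
  | 0 => C1
  | r.+1 => Ext (Cmod (4 ^ r.+1)) CL :|: Ext (Csucc r) Di
  end.

(* C^t is only defined for t >= 1; the value at 0 is irrelevant. *)
Definition Ct (t : nat) : {set vertex (4 ^ t)} :=
  match t return {set vertex (4 ^ t)} with
  | 0 => set0
  | s.+1 => Csucc s
  end.

(* Main.v *)
Require Import Defs.
From mathcomp Require Import all_boot.

Set Implicit Arguments.
Unset Strict Implicit.
Unset Printing Implicit Defensive.

(** The closed neighbourhood of a vertex is the union of the three axis-parallel
    lines through it.  A code that meets every such line exactly once, called
    latin here, is identifying: a codeword sees only itself, and any other
    vertex sees one codeword along each axis, which pins it down
    ([three_axes_determine]).  The codes [Cmod m] are latin, and so is the union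
    of [CL] and [Di] in K_4^3.

    Cut K_{4m}^3 into 64 blocks indexed by the vertices a of K_4^3.  Blocks in
    [CL] carry a copy of [Cmod m], blocks in [Di] a copy of the previous code,
    and the other blocks are empty.  As [CL :|: Di] is latin, a vertex in a
    nonempty block a sees no nonempty block other than a, so it is identified
    inside that block: this is the induction hypothesis for [Di] and the latin
    property for [CL].

    A vertex u in an empty block a sees one codeword along each axis on which a
    sees a block of [CL].  If the coordinates of a are distinct, this happens
    along all three axes and u is determined.  Otherwise two coordinates of a
    agree, the line along the third axis runs through [Di] and may contribute
    nothing, but the other two axes give codewords.  The only vertex other than
    u adjacent to both is the opposite corner of the rectangle that they span
    with u, and that corner lies in a block that sees [CL] along all three axes
    ([mixing]), so it is itself determined and cannot share the identifying set
    of u.  Together this is [block_code_identifying], and the recursion starts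
    at [C1], which is checked by enumeration.

    A latin code has q^2 elements, so |C^(t+1)| = 12 m^2 + 4 |C^t| with m = 4^t,
    which turns m^2 - m/4 into (4m)^2 - m.  Disjointness of [CL] and [Di] comes
    from the same count, 12 + 4 = 16. *)

(** * Neighbourhoods as unions of three axis-parallel lines *)

Variant axis := X | Y | Z.

Definition next_axis (i : axis) : axis :=
  match i with X => Y | Y => Z | Z => X end.

Definition aligned (q : nat) (i : axis) (u v : vertex q) : bool :=
  match i with
  | X => (u.1.2 == v.1.2) && (u.2 == v.2)
  | Y => (u.1.1 == v.1.1) && (u.2 == v.2)
  | Z => (u.1.1 == v.1.1) && (u.1.2 == v.1.2)
  end.

Definition near (q : nat) (u v : vertex q) : bool :=
  [|| aligned X u v, aligned Y u v | aligned Z u v].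

Lemma nearP (q : nat) (u v : vertex q) :
  reflect (exists i, aligned i u v) (near u v).
Proof.
apply: (iffP or3P) => [[H|H|H]|[[H|H|H]]];
  by [exists X|exists Y|exists Z|constructor].
Qed.

Lemma aligned_refl (q : nat) i (u : vertex q) : aligned i u u.
Proof. by case: i => /=; rewrite !eqxx. Qed.

Lemma near_refl (q : nat) (u : vertex q) : near u u.
Proof. by apply/nearP; exists X; apply: aligned_refl. Qed.

Lemma in_Iset (q : nat) (C : {set vertex q}) u w :
  (w \in Iset (@cube_adj q) C u) = near u w && (w \in C).
Proof.
rewrite !inE /near /cube_adj; congr (_ && _).
case: u w => [[x y] z] [[x' y'] z'] /=.
rewrite [_ == (x, y, z)]eq_sym !xpair_eqE.
by do 3!case: (_ == _).
Qed.

Lemma aligned_two_axes (q : nat) i (u v : vertex q) :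
  aligned i u v -> aligned (next_axis i) u v -> u = v.
Proof.
case: u v => [[x y] z] [[x' y'] z'].
by case: i => /= /andP[/eqP a /eqP b] /andP[/eqP c /eqP d]; congruence.
Qed.

(** Two vertices at distance 2 have exactly two common neighbours, the other two
    corners of the rectangle that they span. *)
Lemma opposite_corner (q : nat) i (u v p r : vertex q) :
    aligned i u p -> aligned (next_axis i) u r -> p != u -> r != u ->
    near v p -> near v r ->
  v = u \/ aligned (next_axis i) v p /\ aligned i v r.
Proof.
case: u v p r => [[x y] z] [[x' y'] z'] [[px py] pz] [[rx ry] rz].
rewrite /near.
by case: i => /= /andP[/eqP<- /eqP<-] /andP[/eqP<- /eqP<-];
   rewrite !xpair_eqE !eqxx ?andbT /= => /eqP np /eqP nr;
   do 8?case: eqP => //=; try (by right); move=> *; left; congruence.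
Qed.

(** If [v] were not [u], it would be the opposite corner both for the axes [X],
    [Y] and for the axes [Y], [Z], which forces the neighbour of [u] along [X]
    to be [u] itself. *)
Lemma three_axes_determine (q : nat) (u v : vertex q) :
    (forall i, exists p, [/\ aligned i u p, p != u & near v p]) ->
  v = u.
Proof.
move=> H; have [p [up pu vp]] := H X; have [r [ur ru vr]] := H Y.
have [s [us su vs]] := H Z.
have [//|[vx _]] := opposite_corner up ur pu ru vp vr.
have [//|[vy _]] := opposite_corner ur us ru su vr vs.
have /eqP[] := pu; apply/esym/(aligned_two_axes up).
move: up ur vx vy => /= /andP[_ /eqP->] /andP[/eqP-> _].
by move=> /andP[/eqP<- _] /andP[/eqP<- _]; rewrite !eqxx.
Qed.

(** * Latin codes *)

Definition latin (q : nat) (C : {set vertex q}) : Prop :=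
  (forall i u, exists2 w, w \in C & aligned i u w) /\
  {in C &, forall v w, near v w -> v = w}.

Lemma latin_identifying (q : nat) (C : {set vertex q}) :
  0 < q -> latin C -> identifying_code (@cube_adj q) C.
Proof.
move=> q_gt0 [exC uniqC].
have hit u : exists w, w \in Iset (@cube_adj q) C u.
  have [w wC uw] := exC X u; exists w; rewrite in_Iset wC andbT.
  by apply/nearP; exists X.
have outside u v : u \notin C ->
    Iset (@cube_adj q) C u = Iset (@cube_adj q) C v -> v = u.
  move=> uC Iuv; apply: three_axes_determine => i.
  have [p pC up] := exC i u; exists p; split=> //.
    by apply: contraNneq uC => <-.
  have : p \in Iset (@cube_adj q) C u.
    by rewrite in_Iset pC andbT; apply/nearP; exists i.
  by rewrite Iuv in_Iset => /andP[].
split.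
- have [w] := hit (Ordinal q_gt0, Ordinal q_gt0, Ordinal q_gt0).
  by rewrite in_Iset => /andP[_ wC]; apply/set0Pn; exists w.
- by move=> u; apply/set0Pn.
move=> u v nuv Iuv; apply: nuv.
have [uC|uC] := boolP (u \in C); last by rewrite (outside u v).
have [vC|vC] := boolP (v \in C); last by rewrite (outside v u).
have : u \in Iset (@cube_adj q) C u by rewrite in_Iset near_refl.
by rewrite Iuv in_Iset => /andP[vu _]; rewrite (uniqC v u).
Qed.

(** Projecting along the third axis is a bijection onto the square. *)
Lemma latin_card (q : nat) (C : {set vertex q}) : latin C -> #|C| = q ^ 2.
Proof.
move=> [exC uniqC].
have inj : {in C &, injective (fun v : vertex q => (v.1.1, v.1.2))}.
  move=> v w vC wC [vx vy]; apply: uniqC => //.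
  by apply/nearP; exists Z; rewrite /= vx vy !eqxx.
have -> : q ^ 2 = #|[set: 'I_q * 'I_q]|.
  by rewrite cardsT card_prod card_ord mulnn.
rewrite -(card_in_imset inj); apply: eq_card => -[x y].
rewrite [RHS]inE; apply/imsetP.
case: q {uniqC inj} C exC x y => [|q] C exC x y; first by case: x.
have [w wC /= /andP[/eqP ex /eqP ey]] := exC Z (x, y, ord0).
by exists w; rewrite // -ex -ey.
Qed.

Lemma latin_Cmod (m : nat) : 0 < m -> latin (Cmod m).
Proof.
case: m => // m _.
have solve n : exists x : 'I_m.+1, x + n == 0 %[mod m.+1].
  exists (inord ((m.+1 - n %% m.+1) %% m.+1)).
  rewrite inordK ?ltn_mod // modnDml -modnDmr subnK ?modnn ?mod0n //.
  by rewrite ltnW ?ltn_mod.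
have uniq (x x' : 'I_m.+1) n :
    x + n == 0 %[mod m.+1] -> x' + n == 0 %[mod m.+1] -> x = x'.
  move=> /eqP xn /eqP xn'; apply/val_inj; rewrite /=.
  have /eqP := etrans xn (esym xn').
  by rewrite eqn_modDr !modn_small // => /eqP.
split=> [i [[x y] z]|[[x y] z] [[x' y'] z']].
  case: i.
  - have [w w0] := solve (y.+1 + z.+1).+1.
    exists (w, y, z); rewrite /= ?eqxx // inE /=.
    by move: w0; rewrite addnS -addSn addnA.
  - have [w w0] := solve (x.+1 + z.+1).+1.
    exists (x, w, z); rewrite /= ?eqxx // inE /=.
    by move: w0; rewrite addnS -addSn addnCA addnA.
  - have [w w0] := solve (x.+1 + y.+1).+1.
    exists (x, y, w); rewrite /= ?eqxx // inE /=.
    by move: w0; rewrite addnS -addSn addnC.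
rewrite !inE /= => a b /nearP[[] /= /andP[/eqP e /eqP f]].
- rewrite -{}e -{}f in b *; congr (_, _, _).
  by apply: (uniq _ _ (y.+1 + z.+1).+1); rewrite addnS -addSn addnA.
- rewrite -{}e -{}f in b *; congr (_, _, _).
  by apply: (uniq _ _ (x.+1 + z.+1).+1); rewrite addnS -addSn addnCA addnA.
- rewrite -{}e -{}f in b *; congr (_, _, _).
  by apply: (uniq _ _ (x.+1 + y.+1).+1); rewrite addnS -addSn addnC.
Qed.

(** * The block decomposition *)

Lemma ext_coord_eq (m p : nat) (x y : 'I_m) (a b : 'I_p) :
  (ext_coord x a == ext_coord y b) = (x == y) && (a == b).
Proof.
apply/eqP/andP => [/(congr1 val) /= e|[/eqP-> /eqP-> //]].
have m0 : 0 < m by apply: leq_ltn_trans (ltn_ord x).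
have := congr1 (modn^~ m) e; rewrite /= ![_ + m * _]addnC ![m * _]mulnC.
rewrite !modnMDl !modn_small // => exy; split; first exact/eqP/val_inj.
by move/eqP: e; rewrite exy eqn_add2l eqn_pmul2l.
Qed.

Lemma ext_coord_surj (m p : nat) (k : 'I_(p * m)) :
  exists (x : 'I_m) (a : 'I_p), k = ext_coord x a.
Proof.
have m0 : 0 < m by case: m k => // -[k]; rewrite muln0.
have a_lt : k %/ m < p by rewrite ltn_divLR.
exists (Ordinal (ltn_pmod k m0)), (Ordinal a_lt); apply/val_inj => /=.
by rewrite addnC [m * _]mulnC; apply: divn_eq.
Qed.

Lemma aligned_ext (m p : nat) i (u w : vertex m) (a c : vertex p) :
  aligned i (ext_vertex u a) (ext_vertex w c) = aligned i u w && aligned i a c.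
Proof. by case: i => /=; rewrite !ext_coord_eq andbACA. Qed.

Lemma ext_vertex_inj (m p : nat) (u w : vertex m) (a c : vertex p) :
  ext_vertex u a = ext_vertex w c -> u = w /\ a = c.
Proof.
case: u w a c => [[x y] z] [[x' y'] z'] [[a b] c] [[a' b'] c'] /eqP.
rewrite !xpair_eqE /= !ext_coord_eq => /andP[/andP[]].
by do 3!move=> /andP[/eqP-> /eqP->].
Qed.

Lemma ext_vertex_surj (m p : nat) (U : vertex (p * m)) :
  exists (u : vertex m) (a : vertex p), U = ext_vertex u a.
Proof.
case: U => [[x y] z]; have [u [a ->]] := ext_coord_surj x.
have [v [b ->]] := ext_coord_surj y; have [w [c ->]] := ext_coord_surj z.
by exists (u, v, w), (a, b, c).
Qed.

Lemma in_Ext (m p : nat) (A : {set vertex m}) (B : {set vertex p}) u a :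
  (ext_vertex u a \in Ext A B) = (u \in A) && (a \in B).
Proof.
apply/imset2P/andP => [[w c wA cB /ext_vertex_inj[-> ->]]|[uA aB]] //.
by exists u a.
Qed.

Lemma card_Ext (m p : nat) (A : {set vertex m}) (B : {set vertex p}) :
  #|Ext A B| = #|A| * #|B|.
Proof.
rewrite -cardsX /Ext curry_imset2X card_imset // => -[u a] [w c] /=.
by case/ext_vertex_inj=> -> ->.
Qed.

(** Every vertex in a block [a] that is full for [B] has neighbours along all
    three axes in blocks of [B], which is what [three_axes_determine] needs;
    [a \notin B] makes these neighbours distinct from the vertex. *)
Definition full (p : nat) (B : {set vertex p}) (a : vertex p) : Prop :=
  a \notin B /\ forall i, exists2 c, c \in B & aligned i a c.

(** The condition on empty blocks.  In the second alternative [b] is the block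
    that is the opposite corner of [a] for the blocks [c] and [d].
    Directions come as [i], [next_axis i] because a cyclic shift reaches every
    pair of distinct axes. *)
Definition mixing (p : nat) (B D : {set vertex p}) : Prop :=
  forall a, a \notin B :|: D ->
  full B a \/
  exists i c d, [/\ c \in B /\ aligned i a c,
                    d \in B /\ aligned (next_axis i) a d
                  & forall b, aligned (next_axis i) b c -> aligned i b d ->
                    full B b].

Section BlockCode.

Variables (m p : nat) (A A' : {set vertex m}) (B D : {set vertex p}).
Hypotheses (p_gt0 : 0 < p) (latinA : latin A).
Hypotheses (identA' : identifying_code (@cube_adj m) A').
Hypotheses (latinBD : latin (B :|: D)) (disjBD : [disjoint B & D]).
Hypothesis mixBD : mixing B D.

Let E : {set vertex (p * m)} := Ext A B :|: Ext A' D.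
Let I := Iset (@cube_adj (p * m)) E.

Let in_E w c : (ext_vertex w c \in E) =
  (w \in A) && (c \in B) || (w \in A') && (c \in D).
Proof. by rewrite inE !in_Ext. Qed.

Lemma Iset_local u a w c : a \in B :|: D ->
  ext_vertex w c \in I (ext_vertex u a) -> c = a.
Proof.
move=> aBD; rewrite in_Iset in_E => /andP[/nearP[i]].
rewrite aligned_ext => /andP[_ ac] wcE; apply/esym/latinBD.2 => //.
  by rewrite inE; case/orP: wcE => /andP[_ ->]; rewrite ?orbT.
by apply/nearP; exists i.
Qed.

Lemma near_ext (u w : vertex m) (a : vertex p) :
  near (ext_vertex u a) (ext_vertex w a) = near u w.
Proof. by rewrite /near !aligned_ext !aligned_refl !andbT. Qed.

(** [C] is the code copied into block [a]: [A] or [A']. *)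
Lemma Iset_restrict a : a \in B :|: D -> exists2 C : {set vertex m},
  identifying_code (@cube_adj m) C &
  forall u w, (ext_vertex w a \in I (ext_vertex u a)) =
              (w \in Iset (@cube_adj m) C u).
Proof.
have m_gt0 : 0 < m.
  have [/set0Pn[[[x y] z] _] _ _] := identA'.
  exact: leq_ltn_trans (ltn_ord x).
rewrite inE => /orP[aB|aD].
  exists A; first exact: latin_identifying.
  move=> u w; rewrite !in_Iset near_ext in_E aB (disjointFr disjBD aB).
  by rewrite andbF orbF andbT.
exists A' => // u w.
by rewrite !in_Iset near_ext in_E aD (disjointFl disjBD aD) andbF andbT.
Qed.

Lemma line_hit i u a c : c \in B -> aligned i a c ->
  exists w, ext_vertex w c \in E /\ aligned i (ext_vertex u a) (ext_vertex w c).
Proof.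
move=> cB ac; have [w wA uw] := latinA.1 i u.
by exists w; rewrite in_E wA cB aligned_ext uw ac.
Qed.

Lemma Iset_near (U V P : vertex (p * m)) i :
  I U = I V -> P \in E -> aligned i U P -> near V P.
Proof.
move=> IUV PE UP; have : P \in I U.
  by rewrite in_Iset PE andbT; apply/nearP; exists i.
by rewrite IUV in_Iset => /andP[].
Qed.

Lemma ext_neq (u w : vertex m) (a c : vertex p) : a \notin B -> c \in B ->
  ext_vertex w c != ext_vertex u a.
Proof.
by move=> aB cB; apply: contraNneq aB => /ext_vertex_inj[_ <-].
Qed.

Lemma full_determined u a V : full B a -> I (ext_vertex u a) = I V ->
  V = ext_vertex u a.
Proof.
move=> [aB fa] IV; apply: three_axes_determine => i.
have [c cB ac] := fa i; have [w [wE uw]] := line_hit u cB ac.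
by exists (ext_vertex w c); split; [|exact: ext_neq|exact: Iset_near uw].
Qed.

(** The competitor left by [opposite_corner] lies in a full block, so
    [full_determined] applies to it in place of [ext_vertex u a]. *)
Lemma outside_determined u a V : a \notin B :|: D ->
  I (ext_vertex u a) = I V -> V = ext_vertex u a.
Proof.
move=> aBD IV; have aB : a \notin B by apply: contraNN aBD; rewrite inE => ->.
have [fa|[i [c [d [[cB ac] [dB ad] fb]]]]] := mixBD aBD.
  exact: full_determined.
have [w [wE uw]] := line_hit u cB ac; have [r [rE ur]] := line_hit u dB ad.
have [//|[]] := opposite_corner uw ur (ext_neq u w aB cB) (ext_neq u r aB dB)
                                (Iset_near IV wE uw) (Iset_near IV rE ur).
have [v [b eV]] := ext_vertex_surj V; subst V.
rewrite !aligned_ext => /andP[_ bc] /andP[_ bd].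
by rewrite -(full_determined (fb b bc bd) (esym IV)).
Qed.

Lemma Iset_nonempty U : exists P, P \in I U.
Proof.
have [u [a ->]] := ext_vertex_surj U.
have [aBD|aBD] := boolP (a \in B :|: D).
  have [C [_ neC _] IE] := Iset_restrict aBD.
  by have /set0Pn[w] := neC u; rewrite -IE; exists (ext_vertex w a).
have [i [c [cB ac]]] : exists i c, c \in B /\ aligned i a c.
  have [[_ fa]|[i [c [d [ac _ _]]]]] := mixBD aBD; last by exists i, c.
  by have [c cB ac] := fa X; exists X, c.
have [w [wE uw]] := line_hit u cB ac; exists (ext_vertex w c).
by rewrite in_Iset wE andbT; apply/nearP; exists i.
Qed.

(** The identifying set of a vertex in a nonempty block lies in that block, so
    two such vertices with the same identifying set are in the same block, and
    there the code of the block separates them; a vertex in an empty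
    block is separated from all others by [outside_determined]. *)
Lemma block_code_identifying : identifying_code (@cube_adj (p * m)) E.
Proof.
split=> [|U|U V nUV IUV].
- have [/set0Pn[w _] _ _] := identA'; pose o := Ordinal p_gt0.
  have [P] := Iset_nonempty (ext_vertex w (o, o, o)).
  by rewrite in_Iset => /andP[_ PE]; apply/set0Pn; exists P.
- exact/set0Pn/Iset_nonempty.
have [u [a eU]] := ext_vertex_surj U; have [v [b eV]] := ext_vertex_surj V.
subst U V; apply: nUV.
have [aBD|aBD] := boolP (a \in B :|: D); last first.
  by rewrite (outside_determined aBD IUV).
have [bBD|bBD] := boolP (b \in B :|: D); last first.
  by rewrite -(outside_determined bBD (esym IUV)).
have [P] := Iset_nonempty (ext_vertex u a).
have [w [c ->]] := ext_vertex_surj P => wcI.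
have ca := Iset_local aBD wcI; rewrite /I IUV in wcI.
have cb := Iset_local bBD wcI; subst c; subst b.
have [C [_ _ sepC] IE] := Iset_restrict aBD.
congr ext_vertex; apply/eqP/negPn/negP => /eqP nuv; apply: (sepC _ _ nuv).
by apply/setP => x; rewrite -!IE /I IUV.
Qed.

End BlockCode.

(** * The codes in K_4^3 *)

(** The canonical enumeration of ['I_4] does not reduce, because it decides
    bounds through an opaque reflection lemma; this explicit list makes
    quantification over K_4^3 computable. *)
Definition ords4 : seq 'I_4 :=
  [:: @Ordinal 4 0 isT; @Ordinal 4 1 isT; @Ordinal 4 2 isT; @Ordinal 4 3 isT].

Definition vertices4 : seq (vertex 4) :=
  [seq (xy, z) | xy <- [seq (x, y) | x <- ords4, y <- ords4], z <- ords4].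

Lemma mem_vertices4 v : v \in vertices4.
Proof.
have mem_ords4 (x : 'I_4) : x \in ords4.
  by case: x => [[|[|[|[|]]]]].
by case: v => [[x y] z]; do 2?apply: allpairs_f.
Qed.

Lemma forall_vertices4 (P : pred (vertex 4)) : all P vertices4 -> forall v, P v.
Proof. by move=> /allP H v; apply/H/mem_vertices4. Qed.

Lemma card_by_count (P : pred (vertex 4)) :
  uniq vertices4 -> #|[set v | P v]| = count P vertices4.
Proof.
move=> uV; rewrite -size_filter -(card_uniqP (filter_uniq P uV)).
by apply: eq_card => v; rewrite inE mem_filter mem_vertices4 andbT.
Qed.

Lemma uniq_map_inj (T1 T2 : eqType) (f : T1 -> T2) (s : seq T1) :
  uniq (map f s) -> {in s &, injective f}.
Proof.
elim: s => //= x s IH /andP[fx /IH inj] y z; rewrite !inE.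
have sep t : t \in s -> f x <> f t.
  by move=> ts e; case/negP: fx; rewrite e map_f.
case/predU1P=> [->|ys] /predU1P[->|zs] // e.
- by case: (sep z).
- by case: (sep y).
- exact: inj.
Qed.

Definition axes : seq axis := [:: X; Y; Z].

Lemma forall_axes (R : pred axis) : all R axes -> forall i, R i.
Proof. by rewrite /= andbT => /and3P[RX RY RZ] []. Qed.

Lemma has_axis (R : pred axis) : has R axes -> exists i, R i.
Proof. by rewrite /= orbF => /or3P[]; [exists X | exists Y | exists Z]. Qed.

(** Membership in a finite set does not reduce, so each property is reflected
    for the set of vertices satisfying a computable predicate [P]; unification
    finds [P] by unfolding the code at hand. *)

Section Tests.

Variable P : pred (vertex 4).

Definition words : seq (vertex 4) := filter P vertices4.

Lemma mem_words v : (v \in words) = (v \in [set w | P w]).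
Proof. by rewrite mem_filter mem_vertices4 andbT inE. Qed.

Definition latin_test : bool :=
  all (fun u => all (fun i => has (aligned i u) words) axes) vertices4
  && all (fun v => all (fun w => near v w ==> (v == w)) words) words.

Lemma latin_by_test : latin_test -> latin [set v | P v].
Proof.
case/andP=> /forall_vertices4 exP /allP uniqP; split=> [i u|v w].
  by have /hasP[w] := forall_axes (exP u) i; rewrite mem_words; exists w.
rewrite -!mem_words => vP wP vw.
by have /allP/(_ w wP)/implyP/(_ vw)/eqP := uniqP v vP.
Qed.

Definition full_test (a : vertex 4) : bool :=
  ~~ P a && all (fun i => has (aligned i a) words) axes.

Lemma full_by_test a : full_test a -> full [set v | P v] a.
Proof.
case/andP=> Pa /forall_axes fa; split; first by rewrite inE.
by move=> i; have /hasP[c] := fa i; rewrite mem_words; exists c.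
Qed.

(** The ranges are filtered, instead of guarding the tests by conjunctions,
    because call-by-value evaluation would run the inner loops for every
    candidate. *)
Definition mixing_test (Q : pred (vertex 4)) : bool :=
  all (fun a => [|| P a, Q a, full_test a |
    has (fun i => has (fun c => has (fun d =>
        all full_test
          [seq b <- vertices4 | aligned (next_axis i) b c && aligned i b d])
      [seq d <- words | aligned (next_axis i) a d])
      [seq c <- words | aligned i a c]) axes]) vertices4.

Lemma mixing_by_test (Q : pred (vertex 4)) :
  mixing_test Q -> mixing [set v | P v] [set v | Q v].
Proof.
move=> /forall_vertices4 test a; rewrite !inE => /norP[/negbTE Pa /negbTE Qa].
have := test a; rewrite Pa Qa !orFb => /orP[fa|].
  by left; apply: full_by_test.
move=> /has_axis[i /hasP[c]]; rewrite mem_filter mem_words => /andP[ac cP].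
move=> /hasP[d]; rewrite mem_filter mem_words => /andP[ad dP] /allP fb.
right; exists i, c, d; split=> // b bc bd.
by apply/full_by_test/fb; rewrite mem_filter bc bd mem_vertices4.
Qed.

(** The identifying set as a bit string over the list of codewords, so that the
    separation condition becomes absence of duplicates among 64 strings. *)
Definition trace (u : vertex 4) : seq bool := [seq near u w | w <- words].

Lemma identifying_by_test :
    ~~ nilp words -> all (fun u => has (near u) words) vertices4 ->
    uniq (map trace vertices4) ->
  identifying_code (@cube_adj 4) [set v | P v].
Proof.
move=> nP /forall_vertices4 ne uT; split.
- apply/set0Pn; move: nP; case: words (mem_words) => // w s memw _.
  by exists w; rewrite -memw mem_head.
- move=> u; apply/set0Pn; have /hasP[w wP uw] := ne u.
  by exists w; rewrite in_Iset uw -mem_words.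
move=> u v nuv Iuv; apply: nuv.
apply: (uniq_map_inj uT); rewrite ?mem_vertices4 //.
apply/eq_in_map => w wP; have /setP/(_ w) := Iuv.
by rewrite !in_Iset -mem_words wP !andbT.
Qed.

End Tests.

Lemma Di_diagonal :
  Di = [set v : vertex 4 | (v.1.1 == v.1.2) && (v.1.2 == v.2)].
Proof.
apply/setP => -[[x y] z]; rewrite inE.
apply/imsetP/andP => [[j _ [-> -> ->]]|] /=; first by rewrite eqxx.
by case=> /eqP-> /eqP->; exists z.
Qed.

Lemma C1_identifying : identifying_code (@cube_adj 4) C1.
Proof. by apply: identifying_by_test; vm_compute. Qed.

Lemma card_C1 : #|C1| = 15.
Proof. by rewrite card_by_count; vm_compute. Qed.

Lemma card_CL : #|CL| = 12.
Proof. by rewrite card_by_count; vm_compute. Qed.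

Lemma card_Di : #|Di| = 4.
Proof. by rewrite Di_diagonal card_by_count; vm_compute. Qed.

(** A block outside [CL] with distinct coordinates is full: changing one
    coordinate cannot make all three equal, so its lines miss [Di].  A block
    with exactly two equal coordinates meets [Di] along one line only, and its
    opposite corner for the other two has distinct coordinates; the corner is
    not in [CL], which has only one element on the line through the corner and
    [c]. *)
Lemma CL_Di_mixing : mixing CL Di.
Proof. by rewrite Di_diagonal; apply: mixing_by_test; vm_compute. Qed.

Lemma CL_Di_latin : latin (CL :|: Di).
Proof.
have setU_pred (P Q : pred (vertex 4)) :
    [set v | P v] :|: [set v | Q v] = [set v | P v || Q v].
  by apply/setP => v; rewrite !inE.
by rewrite Di_diagonal setU_pred; apply: latin_by_test; vm_compute.
Qed.

(** Equality in |CL :|: Di| <= |CL| + |Di|, as a latin code has 16 elements. *)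
Lemma CL_Di_disjoint : [disjoint CL & Di].
Proof.
have [_ <-] := leq_card_setU CL Di.
by rewrite (latin_card CL_Di_latin) card_CL card_Di.
Qed.

(** * The recursive codes *)

Lemma Csucc_identifying (s : nat) :
  identifying_code (@cube_adj (4 ^ s.+1)) (Csucc s).
Proof.
elim: s => [|s IH]; first exact: C1_identifying.
apply: (@block_code_identifying (4 ^ s.+1) 4) => //.
- by apply: latin_Cmod; rewrite expn_gt0.
- exact: CL_Di_latin.
- exact: CL_Di_disjoint.
- exact: CL_Di_mixing.
Qed.

Lemma card_Csucc (s : nat) : #|Csucc s| = (4 ^ s.+1) ^ 2 - 4 ^ s.
Proof.
elim: s => [|s IH]; first exact: card_C1.
have disj : [disjoint Ext (Cmod (4 ^ s.+1)) CL & Ext (Csucc s) Di].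
  apply/pred0P => U; apply/negbTE/negP => /=.
  have [u [a ->]] := ext_vertex_surj U; rewrite !in_Ext.
  by case/andP=> /andP[_ aCL] /andP[_]; rewrite (disjointFr CL_Di_disjoint aCL).
have [_] := leq_card_setU (Ext (Cmod (4 ^ s.+1)) CL) (Ext (Csucc s) Di).
rewrite disj => /eqP /= ->; rewrite !card_Ext IH card_CL card_Di.
rewrite (latin_card (latin_Cmod _)) ?expn_gt0 // mulnBl -expnSr.
have small : 4 ^ s.+1 <= (4 ^ s.+1) ^ 2 * 4.
  by rewrite -mulnn -mulnA leq_pmulr // muln_gt0 expn_gt0.
by rewrite addnBA // -mulnDr [4 ^ s.+2]expnSr expnMn.
Qed.

Theorem theorem21 (t : nat) (ht : 2 <= t) :
  identifying_code (@cube_adj (4 ^ t)) (Ct t) /\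
  #|Ct t| = (4 ^ t) ^ 2 - (4 ^ t) %/ 4.
Proof.
case: t ht => // s _; split; first exact: Csucc_identifying.
by rewrite card_Csucc [in _ %/ _]expnS mulKn.
Qed.
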